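(* Consider the system $x_{t+1}=f(x_t,w_t)$ with state space $X$, where the initial distribution $\pi_0$ of $x_0$ is stationary and ergodic under the Markov chain $(x_t)_{t\in\mathbb{Z}_+}$, and let $\mu$ be the associated shift-invariant law on $X^{\mathbb{Z}_+}$. Consider state estimation over a noiseless channel with finite alphabet $\mathcal{M}$ and the following objective (E3) for given $\varepsilon>0$: $$\limsup_{t\to\infty}E\bigl[d(x_t,\hat x_t)^2\bigr]\le\varepsilon.$$ Restrict the coder and estimator as follows: there exists an integer $\tau>0$ such that the coder is of the form $$q_t=\delta_t(x_{[t-\tau+1,t]})\in\mathcal{M},\qquad \delta_{t+\tau}\equiv\delta_t,$$ and the estimator is of the form $$\hat x_t=\gamma_t(q_{[t-\tau+1,t]})\in X,\qquad \gamma_{t+\tau}\equiv\gamma_t.$$ If $\operatorname{supp}\mu$ is compact, then the smallest channel capacity $C_0$ above which (E3) can be achieved for every $\varepsilon>0$ (with coders and estimators of this form) satisfies $$C_0\ \ge\ h_\mu(\theta),$$ where $h_\mu(\theta)$ is the metric (Kolmogorov–Sinai) entropy of the left shift $\theta$ on $X^{\mathbb{Z}_+}$ with respect to $\mu$.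
   Context: All logarithms (including in entropies) are to base 2; $\mathbb{Z}_+=\{0,1,2,\dots\}$. System: $(X,d)$ is a complete metric space, $W$ is a measurable space, $f:X\times W\to X$ is Borel measurable and $f_w:=f(\cdot,w):X\to X$ is a homeomorphism for every $w\in W$. $(w_t)_{t\in\mathbb{Z}_+}$ is an i.i.d. sequence in $W$ with common law $\nu$, independent of $x_0\sim\pi_0$. With $f^x(w):=f(x,w)$, the Markov chain $(x_t)$ has transition kernel $P(B|x)=\nu((f^x)^{-1}(B))$. Shift system: $X^{\mathbb{Z}_+}$ carries the product topology, metrized by $D(\bar x,\bar y)=\sum_{t\ge0}2^{-t}\frac{d(x_t,y_t)}{1+d(x_t,y_t)}$; $\theta:X^{\mathbb{Z}_+}\to X^{\mathbb{Z}_+}$, $(\theta\bar x)_t=x_{t+1}$. The measure $\mu$ is the $\theta$-invariant Borel probability measure given on cylinder sets by $$\mu(B_0\times\cdots\times B_n\times X\times X\times\cdots)=\int_{B_0\times\cdots\times B_n}\pi_0(\mathrm{d}x_0)P(\mathrm{d}x_1|x_0)\cdots P(\mathrm{d}x_n|x_{n-1}).$$ Channel: a noiseless channel with finite alphabet $\mathcal{M}=\{1,\dots,M\}$ delivers each input symbol $q_t\in\mathcal{M}$ unaltered and has capacity $\log|\mathcal{M}|$. Coder maps are measurable. Notation: $z_{[s,t]}=(z_s,\dots,z_t)$; for the finitely many initial times $t<\tau-1$ (windows containing negative times) the coder and estimator simply use the available data, which does not affect the asymptotic objective, and the periodicity conditions refer to full windows. $C_0$ is the infimum of the capacities $\log|\mathcal{M}|$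 of noiseless channels over which, for every $\varepsilon>0$, there exist a coder and an estimator of the stated form (for some $\tau$) achieving the objective with that $\varepsilon$ ($C_0=\infty$ if there are none). *)

(* Defs.v *)
From HB Require Import structures.
From mathcomp Require Import all_boot all_order all_algebra.
From mathcomp Require Import all_classical all_reals all_analysis.

Set Implicit Arguments.
Unset Strict Implicit.
Unset Printing Implicit Defensive.

Import Order.TTheory GRing.Theory Num.Theory.
Import numFieldNormedType.Exports.

Local Open Scope classical_set_scope.
Local Open Scope ring_scope.

#[short(type="completeMetricType")]
HB.structure Definition CompleteMetric (R : numDomainType) :=
  {T of CompletePseudoMetric R T & Metric R T}.

Notation borel T := (g_sigma_algebraType (@open T)).

HB.instance Definition _ (I : Type) (T : I -> ptopologicalType) :=
  Pointed.on (prod_topology T).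

Definition path_space (T : ptopologicalType) : ptopologicalType :=
  prod_topology (fun _ : nat => T).

Definition left_shift (T : Type) (z : nat -> T) : nat -> T := fun t => z t.+1.

Definition homeomorphism (T U : topologicalType) (f : T -> U) : Prop :=
  exists g : U -> T,
    [/\ cancel f g, cancel g f, continuous f & continuous g].

Section topological_support.
Context (R : realType) (T : ptopologicalType).
Local Open Scope ereal_scope.

Definition supp (mu : probability (borel T) R) : set T :=
  [set z | forall U : set T, open U -> U z -> 0 < mu U].

End topological_support.

Section kolmogorov_sinai.
Context (R : realType).

Definition log2 (x : R) : R := ln x / ln 2.

Context (d : measure_display) (T : measurableType d) (mu : probability T R)
  (theta : T -> T).

(* Cells may be empty; with [log2 0 = 0] they contribute nothing to the
   entropy. *)
Definition finite_measurable_partition (I : finType) (A : I -> set T) : Prop :=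
  [/\ forall i, measurable (A i), trivIset setT A & \bigcup_i A i = setT].

Definition partition_entropy (I : finType) (A : I -> set T) : R :=
  - \sum_(i : I) fine (mu (A i)) * log2 (fine (mu (A i))).

(* the join of [theta^-i A] for [i < n], with cells indexed by itineraries *)
Definition iterated_join (I : finType) (A : I -> set T) (n : nat)
    (s : {ffun 'I_n -> I}) : set T :=
  [set z | forall i : 'I_n, A (s i) (iter i theta z)].

(* By subadditivity the limit exists when [theta] preserves [mu]. *)
Definition partition_ks_entropy (I : finType) (A : I -> set T) : \bar R :=
  limn (fun n => (partition_entropy (@iterated_join I A n) / n%:R)%:E).

Definition ks_entropy : \bar R :=
  ereal_sup [set h | exists (k : nat) (A : 'I_k -> set T),
    finite_measurable_partition A /\ h = partition_ks_entropy A].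

End kolmogorov_sinai.

Section markov_chain.
Context (R : realType) (X : completeMetricType R) (dW : measure_display)
  (W : measurableType dW) (f : borel X * W -> borel X) (nu : probability W R).
Local Open Scope ereal_scope.

Definition trans_kernel (x : borel X) : set (borel X) -> \bar R :=
  pushforward nu (fun w => f (x, w)).

Definition stationary (pi0 : probability (borel X) R) : Prop :=
  forall B : set (borel X), measurable B ->
    \int[pi0]_x trans_kernel x B = pi0 B.

(* Invariance of [B] is taken modulo [pi0]-null sets. *)
Definition ergodic (pi0 : probability (borel X) R) : Prop :=
  forall B : set (borel X), measurable B ->
    {ae pi0, forall x, trans_kernel x B = (\1_B x)%:E} ->
    pi0 B = 0 \/ pi0 B = 1.

(* [cylinder_kernel B n x] is the iterated integral
   P(dx_1|x) P(dx_2|x_1) ... P(dx_n|x_{n-1}) over B_1 x ... x B_n. *)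
Fixpoint cylinder_kernel (B : nat -> set (borel X)) (n : nat) (x : borel X)
    : \bar R :=
  if n is m.+1 then
    \int[trans_kernel x]_(y in B 1%N) cylinder_kernel (fun i => B i.+1) m y
  else 1.

Definition path_law (pi0 : probability (borel X) R)
    (mu : probability (borel (path_space X)) R) : Prop :=
  forall (B : nat -> set (borel X)) (n : nat),
    (forall i, measurable (B i)) ->
    mu [set z | forall i, (i <= n)%N -> B i (z i)] =
      \int[pi0]_(x in B 0%N) cylinder_kernel B n x.

Definition theta_invariant (mu : probability (borel (path_space X)) R) : Prop :=
  forall B : set (borel (path_space X)), measurable B ->
    mu ((@left_shift X) @^-1` B) = mu B.

Context (dO : measure_display) (Omega : measurableType dO)
  (P : probability Omega R).

(* The product rule over arbitrary initial segments [t < n] (any [B t] may be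
   the full space) is mutual independence of [x 0], [w 0], [w 1], etc. *)
Record system_process (pi0 : probability (borel X) R)
    (x : nat -> Omega -> borel X) (w : nat -> Omega -> W) : Prop := {
  meas_init : measurable_fun setT (x 0%N) ;
  meas_noise : forall t, measurable_fun setT (w t) ;
  law_init : forall A, measurable A -> P (x 0%N @^-1` A) = pi0 A ;
  law_noise : forall t B, measurable B -> P (w t @^-1` B) = nu B ;
  indep_init_noise : forall (n : nat) (A : set (borel X)) (B : nat -> set W),
    measurable A -> (forall t, measurable (B t)) ->
    P (x 0%N @^-1` A `&` [set o | forall t, (t < n)%N -> B t (w t o)]) =
      P (x 0%N @^-1` A) * \prod_(t < n) P (w t @^-1` B t) ;
  dynamics : forall t o, x t.+1 o = f (x t o, w t o) }.

End markov_chain.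

(* The value at time [t] of a causal map with window length [tau]: [full t] is
   applied to z_{[t-tau+1,t]}, or [init t] to z_{[0,t]} when the window would
   contain negative times. *)
Definition windowed (Y Z : Type) (tau : nat)
    (init : forall t : nat, t.+1.-tuple Y -> Z) (full : nat -> tau.-tuple Y -> Z)
    (z : nat -> Y) (t : nat) : Z :=
  if (t.+1 < tau)%N then init t [tuple z i | i < t.+1]
  else full t [tuple z (t.+1 - tau + i)%N | i < tau].

Section estimation.
Context (R : realType) (X : completeMetricType R) (dO : measure_display)
  (Omega : measurableType dO) (P : probability Omega R)
  (x : nat -> Omega -> borel X).

(* Coder maps are measurable for the product sigma-algebra on tuples.
   The estimator maps have a finite discrete domain, hence carry no
   measurability condition. *)
Definition achieves (M : nat) (eps : R) : Prop :=
  exists tau : nat, (0 < tau)%N /\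
  exists (delta0 : forall t : nat, t.+1.-tuple (borel X) -> 'I_M)
         (delta : nat -> tau.-tuple (borel X) -> 'I_M)
         (gamma0 : forall t : nat, t.+1.-tuple 'I_M -> X)
         (gamma : nat -> tau.-tuple 'I_M -> X),
    let q (o : Omega) := windowed delta0 delta (fun t => x t o) in
    let xhat (o : Omega) := windowed gamma0 gamma (q o) in
    [/\ forall t m, measurable (delta0 t @^-1` [set m]),
        forall t m, measurable (delta t @^-1` [set m]),
        forall t, delta (t + tau)%N = delta t,
        forall t, gamma (t + tau)%N = gamma t
      & (limn_esup (fun t =>
          'E_P[fun o => (mdist (x t o : X) (xhat o t) ^+ 2)%R]) <= eps%:E)%E].

Definition C0 : \bar R :=
  ereal_inf [set (log2 M%:R)%:E | M in
    [set M : nat | (0 < M)%N /\ forall eps : R, 0 < eps -> achieves M eps]].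

End estimation.

(* Main.v *)
From HB Require Import structures.
Require Import Defs.
From mathcomp Require Import all_boot all_order all_algebra.
From mathcomp Require Import all_classical all_reals all_analysis.
From mathcomp Require Import measurable_realfun.
From mathcomp Require Import ring lra.
Set Implicit Arguments.
Unset Strict Implicit.
Unset Printing Implicit Defensive.
Import Order.TTheory GRing.Theory Num.Theory.
Import numFieldNormedType.Exports.
Local Open Scope classical_set_scope.
Local Open Scope ring_scope.

(** Suppose that a channel with [M] symbols allows estimation with arbitrarily
    small mean-square error; the claim is that every finite measurable partition
    of path space has entropy at most [log2 M] under the shift.

    The symbols sent up to time [t0 + m + n], at most [M ^ (t0 + m + n)] strings,
    determine the state estimates up to that time. Suppose that these estimates
    tell, with small error probability at each time, which cell of the partition
    the shifted path is in. A Fano-type inequality ([entropy_decoding]) then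
    bounds the entropy of the itinerary of length [n] by
    [(t0 + m + n) * log2 M] plus [n] times a small constant, and division by [n]
    gives the claim ([trackable_entropy_le], [trackable_ks_entropy_le]).

    The cell of a path can be guessed from an estimate because every Borel set of
    paths is, up to small measure, decided by any sufficiently accurate
    approximation of the path on a finite time window. The sets with this
    property contain the open sets and are stable under complements and
    countable unions ([decodable_measurable], [decodable_partition]).

    The coding scheme is given on the probability space of the state process,
    the partition on path space. The errors of the scheme are events in finitely
    many coordinates, so it suffices that the process has law [mu] on the
    sigma-algebra generated by the cylinders ([process_path_law]); this is the
    Markov property, obtained from the independence of the noise at time [k] from
    the initial state and the earlier noise ([integral_step],
    [process_cylinder_from]). *)

(** * The product topology on path space *)

Section topo.
Context (R : realType) (X : completeMetricType R).

(** A basis of neighbourhoods of [z] in the product topology, indexed by the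
    length [m] of the window and the precision [rho]. *)
Definition close_on (m : nat) (rho : R) (z y : nat -> X) : Prop :=
  forall j, (j < m)%N -> mdist (z j) (y j) < rho.

Lemma coordinate_continuous (j : nat) :
  continuous ((fun z => z j) : path_space X -> X).
Proof. exact: (@proj_continuous nat (fun=> X) j). Qed.

Lemma coordinate_measurable (j : nat) :
  measurable_fun setT ((fun z => z j) : borel (path_space X) -> borel X).
Proof.
apply: (@measurability _ _ (borel (path_space X)) (borel X) setT _ (@open X)) => //.
move=> _ [U oU <-]; rewrite setTI; apply: sub_sigma_algebra.
by apply: open_comp => // z _; exact: coordinate_continuous.
Qed.

Lemma open_mdist_lt (a : X) rho : open [set x : X | mdist x a < rho].
Proof.
rewrite openE => x /= xa; apply/nbhs_ballP; exists (rho - mdist x a) => /=.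
  by rewrite subr_gt0.
move=> y; rewrite ballEmdist /= => xy.
by rewrite (le_lt_trans (metric_triangle y x a))// metric_sym -ltrBrDr.
Qed.

Lemma open_close_on m rho (y : nat -> X) :
  open ([set z | close_on m rho z y] : set (path_space X)).
Proof.
elim: m => [|m IH].
  by rewrite (_ : [set _ | _] = setT); [exact: openT|apply/seteqP; split => // z _ j].
rewrite (_ : [set _ | _] = [set z | close_on m rho z y] `&`
    (fun z : path_space X => z m) @^-1` [set x | mdist x (y m) < rho]).
  apply: openI => //; apply: open_comp.
    by move=> z _; exact: coordinate_continuous.
  exact: open_mdist_lt.
apply/seteqP; split => [z h|z [h1]] /=.
  by split => [j jm|]; [apply: h; rewrite ltnS ltnW|exact: h].
move=> h2 j; rewrite ltnS leq_eqVlt => /orP[/eqP ->//|].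
exact: h1.
Qed.

(** The finite-window balls generate a filter that converges to [z] coordinate
    by coordinate, hence in the product topology, so this filter contains every
    open set around [z]. *)
Lemma open_close_onP (V : set (path_space X)) z : open V -> V z ->
  exists n : nat, forall y, close_on n n.+1%:R^-1 z y -> V y.
Proof.
move=> oV Vz.
pose F : set_system (path_space X) := filter_from setT
  (fun n : nat => [set y | close_on n n.+1%:R^-1 z y]).
have inv_le (a b : nat) : (a <= b)%N -> b.+1%:R^-1 <= a.+1%:R^-1 :> R.
  by move=> ab; rewrite lef_pV2 ?posrE ?ltr0n// ler_nat ltnS.
have FF : Filter F.
  apply: filter_from_filter; first by exists 0%N.
  move=> i j _ _; exists (maxn i j) => // y h.
  split=> k kij; (apply: lt_le_trans; [apply: h|]).
  - by rewrite (leq_trans kij)// leq_maxl.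
  - by rewrite inv_le// leq_maxl.
  - by rewrite (leq_trans kij)// leq_maxr.
  - by rewrite inv_le// leq_maxr.
have Fz : F --> z.
  apply/cvg_sup => i U [/= _ [[B /= oB <-] /= Bz] BU].
  have /nbhs_ballP[e /= e0 eB] : nbhs (z i) B by exact: open_nbhs_nbhs.
  have [k] := ltr_add_invr e0; rewrite add0r => ke.
  exists (maxn k i.+1) => // y zy; apply: BU => /=; apply: eB.
  rewrite ballEmdist /=; apply: (lt_trans (zy i _)); first by rewrite leq_maxr.
  by apply: le_lt_trans ke; apply: inv_le; rewrite leq_maxl.
have [n _ nV] : F V by apply: Fz; exact: open_nbhs_nbhs.
by exists n.
Qed.
End topo.

(** * Borel sets of paths are decided by finite-precision windows *)

Section decodability.
Context (R : realType) (X : completeMetricType R)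
  (mu : probability (borel (path_space X)) R).

(** Membership of a path [z] in [B] can be read off any approximation [y] of [z]
    that is [rho]-accurate at finitely many times, except when [z] lies in the
    small set [E]. The set [E] depends on [z] alone: it serves
    all the approximations of [z] at once. *)
Definition decodable (B : set (borel (path_space X))) : Prop :=
  forall eta : R, 0 < eta ->
  exists (m : nat) (rho : R) (G : set (nat -> X)) (E : set (borel (path_space X))),
    [/\ 0 < rho, measurable E, (mu E <= eta%:E)%E &
        forall z y, ~ E z -> close_on m rho z y -> (G y <-> B z)].

Lemma close_on_le m m' rho rho' (z y : nat -> X) : (m <= m')%N -> rho' <= rho ->
  close_on m' rho' z y -> close_on m rho z y.
Proof.
move=> mm' rr' h j jm; apply: lt_le_trans rr'; apply: h.
exact: leq_trans mm'.
Qed.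

(** Continuity of [mu] from above along the differences, which decrease to the
    empty set. *)
Lemma small_difference (F : (set (borel (path_space X)))^nat) (eta : R) :
  (forall n, measurable (F n)) -> nondecreasing_seq F -> 0 < eta ->
  exists n, (mu (\bigcup_k F k `\` F n) <= eta%:E)%E.
Proof.
move=> mF ndF eta0; set U := \bigcup_k F k.
have mU : measurable U by exact: bigcupT_measurable.
have cap0 : \bigcap_n (U `\` F n) = set0.
  by apply/seteqP; split => // z h; have [[k _ Fk] _] := h 0%N I;
    have [_ /(_ Fk)] := h k I.
have : mu \o (fun n => U `\` F n) @ \oo --> mu (\bigcap_n (U `\` F n)).
  apply: nonincreasing_cvg_mu.
  - by rewrite (le_lt_trans (probability_le1 _ _))// ?ltry//; exact: measurableD.
  - by move=> n; exact: measurableD.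
  - by rewrite cap0.
  - by move=> i j ij; apply/subsetPset; apply: setDS; apply/subsetPset; exact: ndF.
rewrite cap0 measure0 => /fine_cvgP[_].
move=> /cvgrPdist_le /(_ _ eta0)[N _ /(_ N (leqnn N))] /=.
rewrite sub0r normrN => h; exists N.
have fm : mu (U `\` F N) \is a fin_num by rewrite fin_num_measure//; exact: measurableD.
by rewrite -(fineK fm) lee_fin (le_trans (ler_norm _)).
Qed.

(** Let [F n] consist of the paths whose ball of window [n] and radius [r n]
    stays inside [V]; these closed sets increase to [V]. Declare an estimate to
    be in [V] when its ball of radius [r n / 2] stays inside [V]: this answer is
    right for [z] in [F n] by the triangle inequality, and for [z] outside [V]
    because [z] then belongs to that ball. Only [z] in [V] minus [F n] may be
    misjudged. *)
Lemma decodable_open (V : set (borel (path_space X))) :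
  open (V : set (path_space X)) -> decodable V.
Proof.
move=> oV eta eta0.
pose r (n : nat) : R := n.+1%:R^-1.
pose F n := [set z | forall y, close_on n (r n) z y -> V y].
have r_gt0 n : 0 < r n by rewrite invr_gt0 ltr0n.
have close_on_refl n rho z : 0 < rho -> close_on n rho z (z : nat -> X).
  by move=> r0 j _; rewrite mdistxx.
have mF n : measurable (F n : set (borel (path_space X))).
  rewrite -[F n]setCK; apply: measurableC; apply: sub_sigma_algebra.
  rewrite (_ : ~` _ = \bigcup_(y in ~` V) [set z | close_on n (r n) z y]).
    by apply: bigcup_open => y _; exact: open_close_on.
  apply/seteqP; split => [z /existsNP[y /not_implyP[zy nVy]]|z [y nVy zy] h].
    by exists y.
  by apply: nVy; exact: h.
have ndF : nondecreasing_seq F.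
  move=> i j ij; apply/subsetPset => z h y zy; apply: h.
  by apply: close_on_le zy => //; rewrite lef_pV2 ?posrE ?ltr0n// ler_nat ltnS.
have VF : V = \bigcup_k F k.
  apply/seteqP; split => [z Vz|z [k _ /(_ z)]].
    by have [n nV] := open_close_onP oV Vz; exists n.
  by apply; exact: close_on_refl.
have [n En] := small_difference mF ndF eta0.
exists n, (r n / 2), [set y | forall y', close_on n (r n / 2) y y' -> V y'],
  (\bigcup_k F k `\` F n); split => //.
- by rewrite divr_gt0.
- by apply: measurableD => //; exact: bigcupT_measurable.
rewrite -VF => z y nE zy; split => [Gy|Vz].
  by apply: Gy => j jn; rewrite metric_sym; exact: zy.
have Fz : F n z by apply: contrapT => nF; exact: nE.
move=> y' yy'; apply: Fz => j jn.
rewrite (le_lt_trans (metric_triangle _ (y j) _))// [ltRHS](splitr (r n)).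
by rewrite ltrD// ?zy// yy'.
Qed.

Lemma decodableC B : decodable B -> decodable (~` B).
Proof.
move=> dB eta eta0; have [m [rho [G [E [r0 mE muE h]]]]] := dB eta eta0.
exists m, rho, (~` G), E; split => // z y nE zy.
by split => nG; apply: contra_not nG => /(h z y nE zy).
Qed.

Lemma decodable0 : decodable set0.
Proof.
by apply: decodable_open; exact: open0.
Qed.

Lemma decodableU A B : decodable A -> decodable B -> decodable (A `|` B).
Proof.
move=> dA dB eta eta0; have eta2 : 0 < eta / 2 by rewrite divr_gt0.
have [m [rho [G [E [r0 mE muE h]]]]] := dA _ eta2.
have [m' [rho' [G' [E' [r0' mE' muE' h']]]]] := dB _ eta2.
exists (maxn m m'), (Num.min rho rho'), (G `|` G'), (E `|` E'); split => //.
- by rewrite lt_min r0.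
- exact: measurableU.
- apply: (le_trans (measureU2 _ mE mE')).
  by rewrite (splitr eta) EFinD leeD.
- move=> z y /not_orP[nE nE'] zy.
  have [h1 h2] : (G y <-> A z) /\ (G' y <-> B z).
    split; [apply: h|apply: h'] => //; apply: close_on_le zy.
    + by rewrite leq_maxl.
    + by rewrite ge_min lexx.
    + by rewrite leq_maxr.
    + by rewrite ge_min lexx orbT.
  by split => -[] /= => [/h1|/h2|/h1|/h2]; tauto.
Qed.

(** A finite subunion captures all of the union up to a set of measure
    [eta / 2]. *)
Lemma decodable_bigcup (B : (set (borel (path_space X)))^nat) :
  (forall n, measurable (B n)) -> (forall n, decodable (B n)) ->
  decodable (\bigcup_n B n).
Proof.
move=> mB dB eta eta0; have eta2 : 0 < eta / 2 by rewrite divr_gt0.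
pose F n := \big[setU/set0]_(i < n) B i.
have mF n : measurable (F n) by apply: bigsetU_measurable => i _.
have dF n : decodable (F n).
  rewrite /F; elim: n => [|n IH]; first by rewrite big_ord0; exact: decodable0.
  by rewrite big_ord_recr; exact: decodableU.
have ndF : nondecreasing_seq F.
  by move=> i j ij; apply/subsetPset; exact: subset_bigsetU.
have UF : \bigcup_n B n = \bigcup_n F n.
  apply/seteqP; split => [z [n _ Bz]|z [n _]].
    by exists n.+1 => //; rewrite /F big_ord_recr; right.
  by rewrite /F -bigcup_mkord => -[k _ Bk]; exists k.
have [n En] := small_difference mF ndF eta2.
have [m [rho [G [E [r0 mE muE h]]]]] := dF n _ eta2.
have mD : measurable (\bigcup_k F k `\` F n).
  by apply: measurableD => //; exact: bigcupT_measurable.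
exists m, rho, G, (E `|` (\bigcup_k F k `\` F n)); split => //.
- exact: measurableU.
- apply: (le_trans (measureU2 _ mE mD)).
  by rewrite (splitr eta) EFinD leeD.
- rewrite UF => z y /not_orP[nE nD] zy; split => [/(h z y nE zy) Fz|Uz].
    by exists n.
  by apply/(h z y nE zy); apply: contrapT => nF; apply: nD.
Qed.

Lemma decodable_measurable B : measurable B -> decodable B.
Proof.
pose D := [set B | measurable B /\ decodable B].
suff DB : <<s @open (path_space X) >> `<=` D by move=> /DB[].
apply: smallest_sub => [|V oV]; last first.
  by split; [exact: sub_sigma_algebra|exact: decodable_open].
split.
- by split => //; exact: decodable0.
- by move=> A [mA dA]; rewrite setTD; split; [exact: measurableC|exact: decodableC].
- move=> A DA; split; first by apply: bigcupT_measurable => i; have [] := DA i.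
  by apply: decodable_bigcup => i; have [] := DA i.
Qed.

(** Deciding membership in each cell separately, with error [eta / #|I|], names
    the cell of [z], since exactly one of the answers is positive. *)
Lemma decodable_partition (I : finType) (A : I -> set (borel (path_space X)))
    (eta : R) :
  finite_measurable_partition A -> 0 < eta ->
  exists (m : nat) (rho : R) (g : (nat -> X) -> I)
         (E : set (borel (path_space X))),
    [/\ 0 < rho, measurable E, (mu E <= eta%:E)%E &
        forall z y i, ~ E z -> close_on m rho z y -> A i z -> g y = i].
Proof.
move=> [mA tA UA] eta0.
have [i0 _ _] : (\bigcup_i A i) point by rewrite UA.
have cI : 0 < #|I|%:R :> R by rewrite ltr0n; apply/card_gt0P; exists i0.
have eI : 0 < eta / #|I|%:R by rewrite divr_gt0.
have dA i : decodable (A i) by exact: decodable_measurable.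
have /choice[m /choice[rho /choice[G /choice[E H]]]] := fun i => dA i _ eI.
pose mm := \max_(i : I) m i.
pose rr := \big[Num.min/1]_(i : I) rho i.
exists mm, rr, (fun y => odflt i0 [pick i | `[< G i y >]]),
  (\big[setU/set0]_(i : I) E i); split.
- rewrite /rr; elim/big_rec : _ => // i r _ r0.
  by have [ri _ _ _] := H i; rewrite lt_min ri.
- by apply: bigsetU_measurable => i _; have [] := H i.
- apply: (@le_trans _ _ (\sum_(i : I) (eta / #|I|%:R)%:E)%E); last first.
    by rewrite sumEFin lee_fin sumr_const -[leLHS]mulr_natr divfK// gt_eqF.
  suff [] : measurable (\big[setU/set0]_(i : I) E i) /\
    (mu (\big[setU/set0]_(i : I) E i) <= \sum_(i : I) (eta / #|I|%:R)%:E)%E by [].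
  elim/big_rec2 : _ => [|i U s _ [mU Us]]; first by rewrite measure0.
  have [_ mEi Ei _] := H i; split; first exact: measurableU.
  by rewrite (le_trans (measureU2 _ mEi mU))// leeD.
- move=> z y i nE zy Aiz.
  have nEj j : ~ E j z by move=> Ej; apply: nE; rewrite (bigD1 j)//=; left.
  have zyj j : close_on (m j) (rho j) z y.
    apply: close_on_le zy; first exact: leq_bigmax.
    by rewrite /rr (bigD1 j)//= ge_min lexx.
  have Gj j : G j y <-> A j z by have [_ _ _ h] := H j; exact: h.
  case: pickP => [j /asboolP /Gj Ajz /=|/(_ i)]; last by move/asboolPn; rewrite Gj.
  by apply: (tA j i) => //; exists z.
Qed.
End decodability.

(** * Entropy of an itinerary guessed from a message *)

Section entropy_bound.
Context (R : realType).

(** This is [p * ln (r / p) <= r - p], that is [1 + ln t <= t] at [t = r / p]. *)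
Lemma gibbs_term (p r : R) : 0 <= p -> 0 < r ->
  - (p * ln p) <= - (p * ln r) + (r - p).
Proof.
rewrite le_eqVlt => /orP[/eqP <- r0|p0 r0].
  by rewrite !mul0r oppr0 add0r addr0 ltW.
have rp0 : 0 < r / p by rewrite divr_gt0.
have /ler_wpM2l : 1 + ln (r / p) <= r / p.
  by rewrite -[leRHS](lnK rp0) expR_ge1Dx.
move=> /(_ p (ltW p0)); rewrite ln_div// mulrCA divff ?gt_eqF// mulr1.
lra.
Qed.

Lemma gibbs (S : finType) (p r : S -> R) : (forall s, 0 <= p s) ->
  (forall s, 0 < r s) -> \sum_s r s <= \sum_s p s ->
  - \sum_s p s * ln (p s) <= - \sum_s p s * ln (r s).
Proof.
move=> p0 r0 rp; rewrite -!sumrN.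
apply: (@le_trans _ _ (\sum_s (- (p s * ln (r s)) + (r s - p s)))).
  by apply: ler_sum => s _; exact: gibbs_term.
by rewrite big_split/= sumrB gerDl subr_le0.
Qed.

(** A Fano-type bound: [s] is an itinerary, [u] a message and [g i u] the guess
    of [s i] from the message, wrong with probability at most [beta]. Apply
    Gibbs' inequality to the law [r] of the following random itinerary: draw a
    message uniformly, and replace each guess by a uniform letter with
    probability [eta]. For each [s], bounding the sum over messages from below
    by the term of the actual message [u] gives
    [- ln (r s) <= ln #|U| - \sum_i ln (k (s i) (g i u))], where [k] is the
    transition probability of the noise. A right guess costs at most
    [- ln (1 - eta)], a wrong one at most [ln (#|I| / eta)] more. *)
Lemma entropy_decoding (I U : finType) (n : nat)
  (p : {ffun 'I_n -> I} -> U -> R) (g : 'I_n -> U -> I) (eta beta : R) :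
  (forall s u, 0 <= p s u) -> \sum_(s : {ffun 'I_n -> I}) \sum_u p s u = 1 ->
  (0 < #|U|)%N -> (0 < #|I|)%N -> 0 < eta -> eta < 1 ->
  (forall i : 'I_n, \sum_(s : {ffun 'I_n -> I}) \sum_(u | s i != g i u) p s u <= beta) ->
  - \sum_(s : {ffun 'I_n -> I}) (\sum_u p s u) * log2 (\sum_u p s u) <=
    log2 #|U|%:R + n%:R * (- log2 (1 - eta) + beta * log2 (#|I|%:R / eta)).
Proof.
move=> p0 p1 U0 I0 eta0 eta1 err.
have ln2_gt0 : 0 < ln 2 :> R by rewrite ln_gt0// ltr1n.
have cU0 : 0 < #|U|%:R :> R by rewrite ltr0n.
have cI0 : 0 < #|I|%:R :> R by rewrite ltr0n.
have eI0 : 0 < eta / #|I|%:R by rewrite divr_gt0.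
have e10 : 0 < 1 - eta by rewrite subr_gt0.
pose P s := \sum_u p s u.
pose k (a b : I) : R := (a == b)%:R * (1 - eta) + eta / #|I|%:R.
have k0 a b : 0 < k a b.
  by rewrite /k ltr_wpDl// mulr_ge0// ltW.
have k1 b : \sum_a k a b = 1.
  rewrite big_split/= sumr_const -[X in _ + X]mulr_natr divfK ?gt_eqF//.
  rewrite (bigD1 b)//= eqxx mul1r big1 ?addr0; first lra.
  by move=> a /negbTE ->; rewrite mul0r.
pose c := ln (#|I|%:R / eta).
have c0 : 0 <= c.
  by rewrite ln_ge0// ler_pdivlMr// mul1r (le_trans (ltW eta1))// ler1n.
have kc a b : - ln (k a b) <= - ln (1 - eta) + (a != b)%:R * c.
  rewrite /k; have [_|_] /= := eqVneq a b.
    rewrite mul1r mul0r addr0 lerN2 ler_ln ?posrE//; last exact: addr_gt0.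
    by rewrite lerDl ltW.
  rewrite mul0r add0r mul1r /c -[in leLHS]lnV ?posrE// invf_div lerDr.
  by rewrite oppr_ge0 ln_le0// lerBlDr lerDl ltW.
pose r (s : {ffun 'I_n -> I}) := #|U|%:R^-1 * \sum_u \prod_i k (s i) (g i u).
have rprod (s : {ffun 'I_n -> I}) u : #|U|%:R^-1 * \prod_i k (s i) (g i u) <= r s.
  rewrite /r ler_pM2l ?invr_gt0// (bigD1 u)//= lerDl.
  by apply: sumr_ge0 => v _; apply: prodr_ge0 => i _; exact: ltW.
have kprod0 (s : {ffun 'I_n -> I}) u : 0 < \prod_i k (s i) (g i u) by exact: prodr_gt0.
have r0 s : 0 < r s.
  have /card_gt0P[u _] := U0.
  by apply: lt_le_trans (rprod s u); rewrite mulr_gt0// invr_gt0.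
have r1 : \sum_(s : {ffun 'I_n -> I}) r s = 1.
  rewrite -mulr_sumr exchange_big/= (eq_bigr (fun=> 1)) => [|u _].
    by rewrite sumr_const mulVf// gt_eqF.
  rewrite -(bigA_distr_bigA (fun i a => k a (g i u))) (eq_bigr (fun=> 1)) ?big1_eq //.
have rbound (s : {ffun 'I_n -> I}) u : - ln (r s) <= ln #|U|%:R +
    \sum_(i < n) (- ln (1 - eta) + (s i != g i u)%:R * c).
  apply: (@le_trans _ _ (- ln (#|U|%:R^-1 * \prod_i k (s i) (g i u)))).
    by rewrite lerN2 ler_ln ?posrE// mulr_gt0// invr_gt0.
  rewrite lnM ?posrE ?invr_gt0// lnV ?posrE// opprD opprK lerD2l.
  have -> : ln (\prod_i k (s i) (g i u)) = \sum_i ln (k (s i) (g i u)).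
    suff [] : 0 < \prod_i k (s i) (g i u) /\
      ln (\prod_i k (s i) (g i u)) = \sum_i ln (k (s i) (g i u)) by [].
    elim/big_rec2 : _ => [|i x y _ [y0 <-]]; first by rewrite ln1.
    by rewrite mulr_gt0// lnM ?posrE.
  by rewrite -sumrN ler_sum.
have main : - \sum_(s : {ffun 'I_n -> I}) P s * ln (P s) <=
    ln #|U|%:R + n%:R * (- ln (1 - eta) + beta * c).
  apply: (@le_trans _ _ (- \sum_(s : {ffun 'I_n -> I}) P s * ln (r s))).
    by apply: gibbs => //; [move=> s; exact: sumr_ge0|rewrite r1 p1].
  apply: (@le_trans _ _ (\sum_(s : {ffun 'I_n -> I}) \sum_u p s u * (ln #|U|%:R +
      \sum_(i < n) (- ln (1 - eta) + (s i != g i u)%:R * c)))).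
    rewrite -sumrN ler_sum// => s _; rewrite -mulrN mulr_suml ler_sum// => u _.
    by rewrite ler_wpM2l.
  have -> : \sum_(s : {ffun 'I_n -> I}) \sum_u p s u * (ln #|U|%:R +
      \sum_(i < n) (- ln (1 - eta) + (s i != g i u)%:R * c)) =
    ln #|U|%:R + n%:R * - ln (1 - eta) +
      (\sum_(i < n) \sum_(s : {ffun 'I_n -> I}) \sum_(u | s i != g i u) p s u) * c.
    transitivity (\sum_(s : {ffun 'I_n -> I}) \sum_u (p s u *
        (ln #|U|%:R + n%:R * - ln (1 - eta)) +
        \sum_(i < n) (if s i != g i u then p s u else 0) * c)).
      apply: eq_bigr => s _; apply: eq_bigr => u _.
      rewrite big_split/= sumr_const card_ord addrA mulrDr mulr_natl.
      congr (_ + _); rewrite mulr_sumr; apply: eq_bigr => i _.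
      by case: ifP => _; rewrite ?mul1r// !mul0r mulr0.
    under eq_bigr do rewrite big_split/= -mulr_suml exchange_big/=.
    rewrite big_split/= -mulr_suml p1 mul1r exchange_big/= mulr_suml.
    congr (_ + _); apply: eq_bigr => i _; rewrite mulr_suml.
    by apply: eq_bigr => s _; rewrite -mulr_suml -big_mkcond.
  rewrite -addrA lerD2l mulrDr lerD2l mulrA ler_wpM2r//.
  apply: (@le_trans _ _ (\sum_(i < n) beta)); first exact: ler_sum.
  by rewrite sumr_const card_ord mulr_natl.
rewrite -(ler_pM2r ln2_gt0) mulNr mulr_suml.
under eq_bigr do rewrite /log2 -mulrA divfK ?gt_eqF//.
apply: (le_trans main); rewrite /log2 -/c le_eqVlt; apply/orP; left; apply/eqP.
by field; rewrite gt_eqF.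
Qed.
End entropy_bound.

(** * Integrating out an independent variable *)

Section independence.
Context (R : realType) (d d' : measure_display) (Omega : measurableType d)
  (W : measurableType d') (P : probability Omega R) (nu : probability W R)
  (G : set (set Omega)) (w : Omega -> W).
Hypotheses (mG : G `<=` measurable) (GI : setI_closed G) (GT : G setT)
  (mw : measurable_fun setT w)
  (indepG : forall C D, G C -> measurable D ->
    P (C `&` w @^-1` D) = (P C * nu D)%E).

Let OG : measurableType (sigma_display G) := g_sigma_algebraType G.

(** Both sides are finite measures in [C] that agree on the pi-system [G]. *)
Lemma indep_sigma C D : <<s G >> C -> measurable D ->
  P (C `&` w @^-1` D) = (P C * nu D)%E.
Proof.
move=> GC mD.
have mwD : measurable (w @^-1` D) by rewrite -[_ @^-1` _]setTI; exact: mw.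
have fD : nu D \is a fin_num by exact: fin_num_measure.
have rD : 0 <= fine (nu D) by rewrite fine_ge0.
pose m2 : {measure set Omega -> \bar R} := mscale (NngNum rD) P.
have E2 A : m2 A = (P A * nu D)%E.
  by rewrite /m2/= /mscale/= fineK// muleC.
rewrite -E2; apply: (g_sigma_algebra_measure_unique G mG (fun=> setT) _ _
  (mrestr P mwD) m2) GC => //.
- by apply/seteqP; split => // o _; exists 0%N.
- by move=> A GA; rewrite E2 -indepG.
- by move=> _ /=; rewrite /mrestr setTI (le_lt_trans (probability_le1 _ _))// ltry.
Qed.

(** The joint law of the identity, as a map into [Omega] with the coarser
    sigma-algebra generated by [G], and of [w] is a product measure; Tonelli's
    theorem then integrates [w] out. *)
Lemma integral_indep (H : OG * W -> \bar R) :
  measurable_fun setT H -> (forall p, 0 <= H p)%E ->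
  (\int[P]_o H (o, w o) = \int[P]_o \int[nu]_v H (o, v))%E.
Proof.
move=> mH H0.
have sG : <<s G >> `<=` measurable.
  by apply: smallest_sub => //; exact: sigma_algebra_measurable.
have mid : measurable_fun setT (id : Omega -> OG).
  by move=> _ A GA; rewrite setTI; exact: sG.
pose pr : Omega -> OG * W := fun o => (o, w o).
have mpair : measurable_fun setT pr.
  exact: (@measurable_fun_pair _ _ _ Omega OG W (id : Omega -> OG) w mid mw).
pose i : {mfun Omega >-> OG} :=
  HB.pack (id : Omega -> OG)
    (isMeasurableFun.Build _ _ _ _ _ mid).
pose j : {mfun Omega >-> (OG * W)%type} :=
  HB.pack pr
    (isMeasurableFun.Build _ _ _ _ _ mpair).
pose L1 : probability OG R := distribution P i.
pose L : probability (OG * W)%type R := distribution P j.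
have LE A : measurable A -> (L1 \x nu)%E A = L A.
  apply: product_measure_unique => C D mC mD.
  by rewrite /L /= /distribution /pushforward /= -indep_sigma.
transitivity (\int[L]_p H p)%E.
  by rewrite /L ge0_integral_distribution.
transitivity (\int[L1 \x nu]_p H p)%E.
  by apply: eq_measure_integral => A mA _; exact/esym/LE.
rewrite fubini_tonelli1// /L1 ge0_integral_distribution//.
- exact: measurable_fun_fubini_tonelli_F.
- by move=> o; apply: integral_ge0.
Qed.
End independence.

(** * The law of the state process *)

Section process_law.
Context (R : realType) (X : completeMetricType R) (dW : measure_display)
  (W : measurableType dW) (f : borel X * W -> borel X)
  (f_meas : measurable_fun setT f) (nu : probability W R)
  (pi0 : probability (borel X) R)
  (dO : measure_display) (Omega : measurableType dO) (P : probability Omega R)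
  (x : nat -> Omega -> borel X) (w : nat -> Omega -> W)
  (x_process : system_process f nu P pi0 x w).

(** The pi-system of events that depend on the initial state and on the noise
    before time [k]. *)
Definition past (k : nat) : set (set Omega) :=
  [set C | exists (A : set (borel X)) (B : nat -> set W),
    [/\ measurable A, forall t, measurable (B t) &
        C = x 0%N @^-1` A `&` [set o | forall t, (t < k)%N -> B t (w t o)]]].

Lemma measurable_noise_cylinder k (B : nat -> set W) :
  (forall t, measurable (B t)) ->
  measurable [set o | forall t, (t < k)%N -> B t (w t o)].
Proof.
move=> mB; rewrite (_ : [set _ | _] =
    \bigcap_(t in [set t | (t < k)%N]) (w t @^-1` B t)).
  apply: bigcap_measurableType => t _.
  by rewrite -[_ @^-1` _]setTI; exact: (meas_noise x_process).
by apply/seteqP; split => o.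
Qed.

Lemma past_measurable k : past k `<=` measurable.
Proof.
move=> _ [A [B [mA mB ->]]]; apply: measurableI.
  by rewrite -[_ @^-1` _]setTI; exact: (meas_init x_process).
exact: measurable_noise_cylinder.
Qed.

Lemma past_setI k : setI_closed (past k).
Proof.
move=> _ _ [A [B [mA mB ->]]] [A' [B' [mA' mB' ->]]].
exists (A `&` A'), (fun t => B t `&` B' t); split.
- exact: measurableI.
- by move=> t; exact: measurableI.
- apply/seteqP; split => [ o [[a b] [a' b']]|o [[a a'] b]].
    by split => // t tk; split; [exact: b|exact: b'].
  by split; split => // t tk; have [] := b t tk.
Qed.

Lemma past_setT k : past k setT.
Proof.
exists setT, (fun=> setT); split => //.
by apply/seteqP; split => o.
Qed.

Lemma past_le k l : (k <= l)%N -> past k `<=` past l.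
Proof.
move=> kl _ [A [B [mA mB ->]]].
exists A, (fun t => if (t < k)%N then B t else setT); split => //.
  by move=> t; case: ifP.
congr (_ `&` _); apply/seteqP; split => o h t; first by case: ifP => // tk _; exact: h.
by move=> tk; have := h t (leq_trans tk kl); rewrite tk.
Qed.

(** The state at time [k] is a function of the initial state and of the noise
    before time [k]. *)
Lemma state_past_measurable k :
  measurable_fun setT (x k : g_sigma_algebraType (past k) -> borel X).
Proof.
elim: k => [|k IH].
  move=> _ A mA; rewrite setTI; apply: sub_sigma_algebra.
  exists A, (fun=> setT); split => //.
  by apply/seteqP; split => [ o //|o []].
have -> : x k.+1 = f \o (fun o => (x k o, w k o)).
  by apply/funext => o; rewrite (dynamics x_process).
apply: (@measurableT_comp _ _ _ (g_sigma_algebraType (past k.+1))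
  (borel X * W)%type (borel X)) => //.
apply: (@measurable_fun_pair _ _ _ (g_sigma_algebraType (past k.+1)) (borel X) W).
  move=> _ A mA; have := IH measurableT A mA; rewrite !setTI.
  by apply: sub_smallest2r => //; exact: past_le.
move=> _ A mA; rewrite setTI; apply: sub_sigma_algebra.
exists setT, (fun t => if t == k then A else setT); split => //.
  by move=> t; case: ifP.
apply/seteqP; split => [ o Ao|o [_ /(_ k (ltnSn k))]]; last by rewrite eqxx.
by split => // t _; case: eqP => // ->.
Qed.

Lemma noise_indep_past k C D : past k C -> measurable D ->
  P (C `&` w k @^-1` D) = (P C * nu D)%E.
Proof.
move=> [A [B [mA mB ->]]] mD.
pose B' t := if (t < k)%N then B t else D.
have mB' t : measurable (B' t) by rewrite /B'; case: ifP.
have -> : x 0%N @^-1` A `&` [set o | forall t, (t < k)%N -> B t (w t o)] `&`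
    w k @^-1` D = x 0%N @^-1` A `&` [set o | forall t, (t < k.+1)%N -> B' t (w t o)].
  rewrite -setIA; congr (_ `&` _); apply/seteqP; split => [ o [h Do] t|o h].
    by rewrite ltnS leq_eqVlt /B' => /orP[/eqP ->|tk]; rewrite ?ltnn// tk; exact: h.
  split; last by have := h k (ltnSn k); rewrite /B' ltnn.
  by move=> t tk; have := h t (ltnW tk); rewrite /B' tk.
rewrite !(indep_init_noise x_process)// big_ord_recr/= muleA.
congr (_ * _ * _)%E.
  by apply: eq_bigr => t _; rewrite /B' ltn_ord.
by rewrite (law_noise x_process)// /B' ltnn.
Qed.

Lemma state_measurable k : measurable_fun setT (x k).
Proof.
move=> _ A mA; have := @state_past_measurable k measurableT A mA; rewrite !setTI.
have sub : <<s past k >> `<=` measurable.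
  apply: smallest_sub; first exact: sigma_algebra_measurable.
  exact: past_measurable.
exact: sub.
Qed.

(** The Markov property: the noise at time [k] is independent of the past, hence
    can be averaged out of [x k.+1 = f (x k, w k)]. *)
Lemma integral_step k (C : set Omega) (h : borel X -> \bar R) :
  <<s past k >> C -> measurable_fun setT h -> (forall y, 0 <= h y)%E ->
  (\int[P]_(o in C) h (x k.+1 o) =
   \int[P]_(o in C) \int[nu]_v h (f (x k o, v)))%E.
Proof.
move=> GC mh h0.
pose OG : measurableType (sigma_display (past k)) := g_sigma_algebraType (past k).
have mCG : measurable (C : set OG) by [].
pose H (p : OG * W) : \bar R := ((\1_C p.1)%:E * h (f (x k p.1, p.2)))%E.
have mH : measurable_fun setT H.
  have m1 : measurable_fun setT (fun p : OG * W => \1_C p.1 : R).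
    exact: (measurableT_comp (measurable_indic mCG) measurable_fst).
  have m2 : measurable_fun setT (fun p : OG * W => x k p.1).
    exact: (measurableT_comp (@state_past_measurable k : measurable_fun setT
      (x k : OG -> borel X)) measurable_fst).
  apply: emeasurable_funM; first exact/measurable_EFinP.
  apply: (measurableT_comp mh); apply: (measurableT_comp f_meas).
  exact: measurable_fun_pair.
have H0 p : (0 <= H p)%E by rewrite mule_ge0// lee_fin.
rewrite integral_mkcond [RHS]integral_mkcond.
transitivity (\int[P]_o H (o, w k o))%E.
  apply: eq_integral => o _; rewrite /H /= patchE indicE (dynamics x_process).
  by case: ifP => _; rewrite ?mul1e ?mul0e.
rewrite (integral_indep (@past_measurable k) (@past_setI k) (past_setT k)
  (meas_noise x_process k) (@noise_indep_past k) mH H0).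
apply: eq_integral => o _; rewrite patchE /H /= indicE; case: ifP => _.
  by apply: eq_integral => v _; rewrite mul1e.
by under eq_integral do rewrite mul0e; rewrite integral0.
Qed.

Lemma trans_kernel_integral y (D : set (borel X)) (h : borel X -> \bar R) :
  measurable D -> measurable_fun setT h -> (forall z, 0 <= h z)%E ->
  (\int[trans_kernel f nu y]_(z in D) h z = \int[nu]_v (h \_ D) (f (y, v)))%E.
Proof.
move=> mD mh h0.
rewrite /trans_kernel ge0_integral_pushforward//.
- by rewrite integral_mkcond; apply: eq_integral => v _; rewrite !patchE.
- by apply: measurableT_comp => //; exact: measurable_fun_pair.
- exact: measurable_funTS.
Qed.

Lemma cylinder_kernel_measurable_ge0 n (B : nat -> set (borel X)) :
  (forall i, measurable (B i)) ->
  measurable_fun setT (cylinder_kernel f nu B n) /\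
  (forall y, 0 <= cylinder_kernel f nu B n y)%E.
Proof.
elim: n B => [|n IH] B mB; first by split => //=; exact: measurable_cst.
have [mk k0] := IH _ (fun i => mB i.+1).
pose h y := (cylinder_kernel f nu (fun i => B i.+1) n \_ (B 1%N)) y.
have mh : measurable_fun setT h.
  by apply/(measurable_restrictT _ (mB 1%N)); exact: measurable_funTS.
have h0 y : (0 <= h y)%E by rewrite /h patchE; case: ifP.
have mhf : measurable_fun setT (h \o f) by exact: measurableT_comp.
have -> : cylinder_kernel f nu B n.+1 = fubini_F nu (h \o f).
  by apply/funext => y; rewrite /= trans_kernel_integral.
split; first by apply: measurable_fun_fubini_tonelli_F => // p; exact: h0.
by move=> y; apply: integral_ge0 => v _; exact: h0.
Qed.

Lemma cylinder_kernel_ge0 n (B : nat -> set (borel X)) y :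
  (forall i, measurable (B i)) -> (0 <= cylinder_kernel f nu B n y)%E.
Proof. by move=> mB; have [] := cylinder_kernel_measurable_ge0 n mB. Qed.

Lemma measurable_cylinder_kernel n (B : nat -> set (borel X)) :
  (forall i, measurable (B i)) -> measurable_fun setT (cylinder_kernel f nu B n).
Proof. by move=> mB; have [] := cylinder_kernel_measurable_ge0 n mB. Qed.

Lemma cylinder_past k (B : nat -> set (borel X)) :
  (forall i, measurable (B i)) ->
  <<s past k >> [set o | forall i, (i <= k)%N -> B i (x i o)].
Proof.
move=> mB.
pose OG : measurableType (sigma_display (past k)) := g_sigma_algebraType (past k).
suff : measurable ([set o | forall i, (i <= k)%N -> B i (x i o)] : set OG) by [].
rewrite (_ : [set _ | _] = \bigcap_(i in [set i | (i <= k)%N]) (x i @^-1` B i)).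
  apply: bigcap_measurableType => i /= ik.
  have := @state_past_measurable i measurableT (B i) (mB i); rewrite setTI.
  by apply: sub_smallest2r => //; exact: past_le.
by apply/seteqP; split => z.
Qed.

(** The integral over the constraints up to time [j] of the conditional
    probability of the remaining ones. Induction on the number [m] of remaining
    coordinates, the last of them being integrated out first; the law of the
    whole cylinder is the case [j = 0]. *)
Lemma process_cylinder_from m j (B : nat -> set (borel X)) :
  (forall i, measurable (B i)) ->
  (P [set o | forall i, (i <= j + m)%N -> B i (x i o)] =
   \int[P]_(o in [set o | forall i, (i <= j)%N -> B i (x i o)])
     cylinder_kernel f nu (fun i => B (j + i)%N) m (x j o))%E.
Proof.
move=> mB.
have mC l : measurable [set o | forall i, (i <= l)%N -> B i (x i o)].
  have sub : <<s past l >> `<=` measurable.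
    apply: smallest_sub; first exact: sigma_algebra_measurable.
    exact: past_measurable.
  by apply: sub; exact: cylinder_past.
elim: m j => [|m IH] j; first by rewrite addn0 /= integral_cst// mul1e.
rewrite addnS -addSn IH.
pose h y := (cylinder_kernel f nu (fun i => B (j.+1 + i)%N) m \_ (B j.+1)) y.
have mh : measurable_fun setT h.
  apply/(measurable_restrictT _ (mB _)); apply: measurable_funTS.
  exact: measurable_cylinder_kernel.
have h0 y : (0 <= h y)%E.
  by rewrite /h patchE; case: ifP => // _; exact: cylinder_kernel_ge0.
transitivity (\int[P]_(o in [set o | forall i, (i <= j)%N -> B i (x i o)])
    h (x j.+1 o))%E.
  rewrite integral_mkcond [RHS]integral_mkcond; apply: eq_integral => o _.
  rewrite !patchE /h patchE.
  have [Cj|nCj] := pselect ([set o | forall i, (i <= j)%N -> B i (x i o)] o).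
    rewrite (mem_set Cj); have [Bj|nBj] := pselect (B j.+1 (x j.+1 o)).
      rewrite (mem_set Bj) mem_set//= => i.
      by rewrite leq_eqVlt => /orP[/eqP ->//|]; rewrite ltnS; exact: Cj.
    by rewrite (memNset nBj) memNset//= => /(_ _ (leqnn _)).
  rewrite (memNset nCj) memNset//= => h'; apply: nCj => i ij.
  by apply: h'; exact: leqW.
rewrite integral_step//; last exact: cylinder_past.
have mk : (fun i => B (j + i.+1)%N) = (fun i => B (j.+1 + i)%N).
  by apply/funext => i; rewrite addnS.
apply: eq_integral => o _ /=; rewrite trans_kernel_integral//.
- by rewrite mk addn1.
- by rewrite mk; exact: measurable_cylinder_kernel.
- by move=> z; rewrite mk; exact: cylinder_kernel_ge0.
Qed.

Lemma process_cylinder n (B : nat -> set (borel X)) :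
  (forall i, measurable (B i)) ->
  (P [set o | forall i, (i <= n)%N -> B i (x i o)] =
   \int[pi0]_(y in B 0%N) cylinder_kernel f nu B n y)%E.
Proof.
move=> mB; have := process_cylinder_from n 0 mB; rewrite add0n => ->.
have -> : [set o | forall i, (i <= 0)%N -> B i (x i o)] = x 0%N @^-1` B 0%N.
  apply/seteqP; split => [ o /(_ 0%N)|o Bo i]; first exact.
  by rewrite leqn0 => /eqP ->.
pose x0 : {mfun Omega >-> borel X} :=
  HB.pack (x 0%N) (isMeasurableFun.Build _ _ _ _ _ (meas_init x_process)).
transitivity (\int[distribution P x0]_(y in B 0%N) cylinder_kernel f nu B n y)%E.
  rewrite ge0_integral_pushforward//.
  - by apply: measurable_funTS; exact: measurable_cylinder_kernel.
  - by move=> y _; exact: cylinder_kernel_ge0.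
by apply: eq_measure_integral => A mA _; exact: (law_init x_process).
Qed.

End process_law.

Section cylinder_algebra.
Context (R : realType) (X : completeMetricType R).

Definition state_cylinders : set (set (path_space X)) :=
  [set S | exists (n : nat) (B : nat -> set (borel X)),
    (forall i, measurable (B i)) /\
    S = [set z | forall i, (i <= n)%N -> B i (z i)]].

Lemma state_cylinders_setI : setI_closed state_cylinders.
Proof.
move=> _ _ [n [B [mB ->]]] [n' [B' [mB' ->]]].
exists (maxn n n'), (fun i => (if (i <= n)%N then B i else setT) `&`
  (if (i <= n')%N then B' i else setT)); split.
  by move=> i; apply: measurableI; case: ifP.
apply/seteqP; split => [z [h h'] i _|z h].
  by split; case: ifP => //; [exact: h|exact: h'].
split=> i ij; have [] := h i.
- by rewrite (leq_trans ij)// leq_maxl.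
- by rewrite ij.
- by rewrite (leq_trans ij)// leq_maxr.
- by rewrite ij.
Qed.

Lemma state_cylinders_setT : state_cylinders setT.
Proof. by exists 0%N, (fun=> setT); split => //; apply/seteqP; split. Qed.

Lemma process_measurable d (T : measurableType d) (x : nat -> T -> borel X) :
  (forall t, measurable_fun setT (x t)) ->
  measurable_fun setT
    ((fun o t => x t o) : T -> g_sigma_algebraType state_cylinders).
Proof.
move=> mx; apply: (@measurability _ _ T (g_sigma_algebraType state_cylinders)
  setT _ state_cylinders) => //.
move=> _ [_ [n [B [mB ->]]] <-]; rewrite setTI.
rewrite (_ : _ @^-1` _ = \bigcap_(i in [set i | (i <= n)%N]) (x i @^-1` B i)).
  by apply: bigcap_measurableType => i _; rewrite -[_ @^-1` _]setTI; exact: mx.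
by apply/seteqP; split => z.
Qed.

Lemma cylinder_coordinate_measurable (j : nat) :
  measurable_fun setT
    ((fun z => z j) : g_sigma_algebraType state_cylinders -> borel X).
Proof.
move=> _ A mA; rewrite setTI; apply: sub_sigma_algebra.
exists j, (fun i => if i == j then A else setT); split.
  by move=> i; case: ifP.
apply/seteqP; split => [z Az i _|z /(_ j (leqnn j))]; last by rewrite eqxx.
by case: eqP => // ->.
Qed.

End cylinder_algebra.

Section process_path_law.
Context (R : realType) (X : completeMetricType R) (dW : measure_display)
  (W : measurableType dW) (f : borel X * W -> borel X)
  (f_meas : measurable_fun setT f) (nu : probability W R)
  (pi0 : probability (borel X) R)
  (dO : measure_display) (Omega : measurableType dO) (P : probability Omega R)
  (x : nat -> Omega -> borel X) (w : nat -> Omega -> W)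
  (x_process : system_process f nu P pi0 x w)
  (mu : probability (borel (path_space X)) R) (mu_law : path_law f nu pi0 mu).

(** The two laws agree on cylinders, a pi-system. They are compared on the
    sigma-algebra generated by the cylinders, where both are defined; it may be
    smaller than the Borel sigma-algebra of the product when the state space is
    not separable. *)
Lemma process_path_law S : <<s @state_cylinders R X >> S ->
  P ((fun o t => x t o) @^-1` S) = mu S.
Proof.
pose C := @state_cylinders R X.
pose CT : measurableType (sigma_display C) := g_sigma_algebraType C.
pose Z : Omega -> CT := fun o t => x t o.
pose V : borel (path_space X) -> CT := fun z t => z t.
have mZ : measurable_fun setT Z.
  by apply: process_measurable; exact: (state_measurable f_meas x_process).
have mV : measurable_fun setT V.
  by apply: process_measurable => t; exact: coordinate_measurable.
pose mfZ : {mfun Omega >-> CT} := HB.pack Z (isMeasurableFun.Build _ _ _ _ _ mZ).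
pose mfV : {mfun borel (path_space X) >-> CT} :=
  HB.pack V (isMeasurableFun.Build _ _ _ _ _ mV).
move=> CS.
apply: (@measure_unique _ R CT C (fun=> setT) _ _ _ _
  (distribution P mfZ) (distribution mu mfV)) => //.
- exact: state_cylinders_setI.
- by move=> _; exact: state_cylinders_setT.
- by apply/seteqP; split => z // _; exists 0%N.
- move=> _ [n [B [mB ->]]]; rewrite /= /distribution /pushforward /=.
  by rewrite (process_cylinder f_meas x_process n mB) -(mu_law n mB).
- by move=> _; rewrite /= /distribution /pushforward preimage_setT probability_setT ltry.
Qed.
End process_path_law.

(** * Finite-valued maps, iterates of the shift, and causality *)

Section finite_valued.
Context (R : realType) (d : measure_display) (T : measurableType d)
  (mu : probability T R) (J : finType) (Phi : T -> J).
Hypothesis mPhi : forall j, measurable [set z | Phi z = j].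

Lemma finite_valued_measurable (C : set J) : measurable [set z | C (Phi z)].
Proof.
rewrite (_ : [set _ | _] = \bigcup_(j in C) [set z | Phi z = j]).
  by apply: fin_bigcup_measurable => // j _.
by apply/seteqP; split => [z Cz|z [j Cj /= ->]//]; exists (Phi z).
Qed.

Lemma finite_valued_law (C : pred J) :
  \sum_(j | C j) fine (mu [set z | Phi z = j]) = fine (mu [set z | C (Phi z)]).
Proof.
have H (r : seq J) : uniq r ->
    \sum_(j <- r) fine (mu [set z | Phi z = j]) = fine (mu [set z | Phi z \in r]).
  elim: r => [_|j r IH /= /andP[jr /IH {}IH]].
    by rewrite big_nil (_ : [set _ | _] = set0) ?measure0//; apply/seteqP; split.
  have mr : measurable [set z | Phi z \in r].
    by have := finite_valued_measurable [set j | j \in r].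
  rewrite big_cons IH (_ : [set z | Phi z \in j :: r] =
    [set z | Phi z = j] `|` [set z | Phi z \in r]); last first.
    apply/seteqP; split => z /=; rewrite inE.
      by move=> /orP[/eqP|]; [left|right].
    by move=> [->|->]; rewrite ?eqxx ?orbT.
  rewrite measureU// ?fineD ?fin_num_measure//.
  by apply/seteqP; split => // z [/= -> h]; rewrite h in jr.
rewrite -big_enum H ?enum_uniq//; congr (fine (mu _)).
by apply/seteqP; split => z /=; rewrite mem_enum.
Qed.

End finite_valued.

Lemma measurable_forall_fin d (T : measurableType d) (J : finType)
    (D : J -> set T) : (forall j, measurable (D j)) ->
  measurable [set z | forall j, D j z].
Proof.
move=> mD; rewrite (_ : [set _ | _] = \bigcap_j D j).
  by apply: fin_bigcap_measurable.
by apply/seteqP; split => z h j //; exact: h.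
Qed.

Section shift.
Context (R : realType) (X : completeMetricType R).
Notation shift := (@left_shift X).

Lemma iter_shiftE k (z : nat -> X) j : iter k shift z j = z (k + j)%N.
Proof.
elim: k z j => // k IH z j.
by rewrite iterS /left_shift -/(left_shift _) IH addnS.
Qed.

Lemma shift_continuous : continuous (shift : path_space X -> path_space X).
Proof.
move=> z; apply/cvg_sup => i U [/= _ [[B /= oB <-] /= Bz] BU].
apply: filterS BU _ => /=.
have : nbhs (z i.+1) B by exact: open_nbhs_nbhs.
exact: coordinate_continuous.
Qed.

Lemma shift_measurable :
  measurable_fun setT (shift : borel (path_space X) -> borel (path_space X)).
Proof.
apply: (@measurability _ _ (borel (path_space X)) (borel (path_space X)) setT _
  (@open (path_space X))) => //.
move=> _ [U oU <-]; rewrite setTI; apply: sub_sigma_algebra.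
by apply: open_comp => // z _; exact: shift_continuous.
Qed.

Lemma iter_shift_measurable k (B : set (borel (path_space X))) :
  measurable B -> measurable (iter k shift @^-1` B : set (borel (path_space X))).
Proof.
elim: k B => // k IH B mB.
have : measurable (shift @^-1` B : set (borel (path_space X))).
  by rewrite -[_ @^-1` _]setTI; exact: shift_measurable.
exact: IH.
Qed.

Lemma iter_shift_invariant (mu : probability (borel (path_space X)) R) k
    (B : set (borel (path_space X))) :
  theta_invariant mu -> measurable B -> mu (iter k shift @^-1` B) = mu B.
Proof.
move=> inv; elim: k B => // k IH B mB.
have mB' : measurable (shift @^-1` B : set (borel (path_space X))).
  exact: (@iter_shift_measurable 1).
by rewrite -[RHS]inv// -(IH _ mB').
Qed.
End shift.

(** Causality: only the arguments up to time [t] enter. *)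
Lemma windowed_local (Y Z : Type) tau (init : forall t : nat, t.+1.-tuple Y -> Z)
    (full : nat -> tau.-tuple Y -> Z) (y y' : nat -> Y) t :
  (0 < tau)%N -> (forall i, (i <= t)%N -> y i = y' i) ->
  windowed init full y t = windowed init full y' t :> Z.
Proof.
move=> tau0 yy'; rewrite /windowed; case: ifP => [_|/negbT].
  by congr (init t _); apply: eq_from_tnth => i; rewrite !tnth_mktuple yy'// -ltnS.
rewrite -leqNgt => tt; congr (full t _); apply: eq_from_tnth => i.
rewrite !tnth_mktuple yy'//.
by rewrite -ltnS -[ltnRHS](subnK tt) ltn_add2l.
Qed.

(** * The coding scheme on path space *)

(** What the coding scheme provides on path space: a symbol process [q] with [M]
    letters and a causal decoder [dec] whose error at late times is small in
    probability. The bound [2 * eps / rho ^+ 2] is Chebyshev's, the factor 2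
    making up for the passage from a limit superior to late times. *)
Definition trackable (R : realType) (X : completeMetricType R)
    (mu : probability (borel (path_space X)) R) (M : nat) (eps : R) : Prop :=
  exists (q : (nat -> X) -> nat -> 'I_M) (dec : (nat -> 'I_M) -> nat -> X),
    [/\ forall t m, measurable ([set z | q z t = m] : set (borel (path_space X))),
        forall y y' t, (forall i, (i <= t)%N -> y i = y' i) -> dec y t = dec y' t
      & exists t0, forall t, (t0 <= t)%N -> forall rho, 0 < rho ->
          measurable ([set z | rho <= mdist (z t) (dec (q z) t)]
            : set (borel (path_space X))) /\
          (mu [set z | (rho <= mdist (z t) (dec (q z) t))%R] <=
            (2 * eps / rho ^+ 2)%:E)%E].

Section tracking.
Context (R : realType) (X : completeMetricType R) (dW : measure_display)
  (W : measurableType dW) (f : borel X * W -> borel X)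
  (f_meas : measurable_fun setT f) (nu : probability W R)
  (pi0 : probability (borel X) R)
  (dO : measure_display) (Omega : measurableType dO) (P : probability Omega R)
  (x : nat -> Omega -> borel X) (w : nat -> Omega -> W)
  (x_process : system_process f nu P pi0 x w)
  (mu : probability (borel (path_space X)) R) (mu_law : path_law f nu pi0 mu).

Lemma measurable_mdist_ge (c : X) (r : R) :
  measurable ([set y | r <= mdist y c] : set (borel X)).
Proof.
rewrite (_ : [set _ | _] = ~` [set y | mdist y c < r]).
  by apply: measurableC; apply: sub_sigma_algebra; exact: open_mdist_lt.
by apply/seteqP; split => y /=; [rewrite leNgt => /negP|move/negP; rewrite -leNgt].
Qed.

(** Coder and decoder read finitely many coordinates through measurable maps, so
    that every event below is in the sigma-algebra of the cylinders, where [mu]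
    is the law of the process; Chebyshev's inequality converts the mean-square
    error into probabilities. *)
Lemma achieves_tracking M (eps : R) : (0 < M)%N -> 0 < eps ->
  achieves P x M eps ->
  trackable mu M eps.
Proof.
move=> M0 eps0 [tau [tau0 [delta0 [delta [gamma0 [gamma]]]]]] /=.
move=> [mdelta0 mdelta _ _ lim].
pose C := @state_cylinders R X.
pose CT : measurableType (sigma_display C) := g_sigma_algebraType C.
pose q (z : nat -> X) := windowed delta0 delta (z : nat -> borel X).
pose dec : (nat -> 'I_M) -> nat -> X := windowed gamma0 gamma.
have dec_local y y' t : (forall i, (i <= t)%N -> y i = y' i) ->
    dec y t = dec y' t by exact: windowed_local.
have mcoord (j : nat) : measurable_fun setT (fun z : CT => z j : borel X).
  exact: cylinder_coordinate_measurable.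
have mtuple n (s : 'I_n -> nat) :
    measurable_fun setT (fun z : CT => [tuple (z (s i) : borel X) | i < n]).
  apply/measurable_fun_tnthP => i.
  rewrite (_ : _ \o _ = fun z : CT => z (s i) : borel X); first exact: mcoord.
  by apply/funext => z /=; rewrite tnth_mktuple.
have mq t m : measurable ([set z | q z t = m] : set CT).
  rewrite /q /windowed; case: (t.+1 < tau)%N.
    by have := @mtuple t.+1 (fun i => i) measurableT _ (mdelta0 t m); rewrite setTI.
  have := @mtuple tau (fun i => t.+1 - tau + i)%N measurableT _ (mdelta t m).
  by rewrite setTI.
have CTborel (S : set CT) : measurable S -> measurable (S : set (borel (path_space X))).
  have mV := @process_measurable R X _ (borel (path_space X)) (fun t z => z t)
    (@coordinate_measurable R X).
  by move=> mS; have := mV measurableT S mS; rewrite setTI.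
pose Bad t rho : set CT := [set z | rho <= mdist (z t : X) (dec (q z) t)].
have mBad t rho : measurable (Bad t rho).
  pose ext (u : {ffun 'I_t.+1 -> 'I_M}) : nat -> 'I_M := fun j => u (inord j).
  have extE z (u : {ffun 'I_t.+1 -> 'I_M}) : (forall i : 'I_t.+1, q z i = u i) ->
      dec (q z) t = dec (ext u) t.
    move=> qu; apply: dec_local => i it.
    by rewrite /ext -(qu (inord i)) inordK.
  (* The decoded state takes one constant value for each of the finitely many
     symbol strings up to time t. *)
  rewrite (_ : Bad t rho = \bigcup_(u in [set: {ffun 'I_t.+1 -> 'I_M}])
    ([set z : CT | forall i : 'I_t.+1, q z i = u i] `&`
     (fun z : CT => z t : borel X) @^-1` [set y | rho <= mdist y (dec (ext u) t)])).
    apply: fin_bigcup_measurable => // u _; apply: measurableI.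
      by apply: measurable_forall_fin => i; exact: mq.
    by rewrite -[_ @^-1` _]setTI; apply: mcoord => //; exact: measurable_mdist_ge.
  apply/seteqP; split => [z Bz|z [u _ [qu] /=]].
    exists [ffun i : 'I_t.+1 => q z i] => //; split => [i|]; first by rewrite ffunE.
    by rewrite /= -(extE z) // => i; rewrite ffunE.
  by rewrite -(extE z).
exists q, dec; split => //.
  by move=> t m; apply: CTborel; exact: mq.
have [t0 ht0] : exists t0, forall t, (t0 <= t)%N ->
    ('E_P[fun o => (mdist (x t o : X) (dec (q (fun t => x t o)) t) ^+ 2)%R]
       <= (2 * eps)%:E)%E.
  have : (limn_esup (fun t =>
    'E_P[fun o => (mdist (x t o : X) (dec (q (fun t => x t o)) t) ^+ 2)%R])
      < (2 * eps)%:E)%E.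
    by apply: le_lt_trans lim _; rewrite lte_fin ltr_pMl// ltr1n.
  move=> /ereal_inf_lt[_ [A [n _ nA] <-]] /ltW sA; exists n => t nt.
  by apply: le_trans sA; apply: ereal_sup_ubound; exists t => //; exact: nA.
exists t0 => t tt rho rho0; split; first exact: (CTborel _ (mBad t rho)).
pose Z : Omega -> CT := fun o t => x t o.
have mZ : measurable_fun setT Z.
  by apply: process_measurable; exact: (state_measurable f_meas x_process).
rewrite -[X in mu X]/(Bad t rho) -(process_path_law f_meas x_process mu_law (mBad t rho)).
pose e o := mdist (x t o : X) (dec (q (fun t => x t o)) t).
have me : measurable_fun setT e.
  apply: (measurability _ (RGenCInfty.measurableE R)) => //.
  move=> _ [_ [r ->] <-]; rewrite setTI set_itvE.
  have := mZ measurableT _ (mBad t r); rewrite setTI; congr (measurable _).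
pose E : {mfun Omega >-> R} := HB.pack e (isMeasurableFun.Build _ _ _ _ _ me).
have := @markov _ _ _ P E (fun r => r ^+ 2) rho rho0.
rewrite (_ : [set o | (rho%:E <= `|(E o)%:E|)%E] = Z @^-1` Bad t rho); last first.
  by apply/seteqP; split => o /=; rewrite lee_fin ger0_norm// mdist_ge0.
rewrite (_ : _ \o E = fun o => e o ^+ 2); last first.
  by apply/funext => o /=; rewrite ger0_norm// mdist_ge0.
move=> mk.
have rho2 : 0 < rho ^+ 2 by rewrite exprn_gt0.
have {}mk : ((rho ^+ 2)%:E * P (Z @^-1` Bad t rho) <= (2 * eps)%:E)%E.
  apply: le_trans (ht0 _ tt); apply: mk.
  - by have := @measurable_funX _ _ R setT id 2 (@measurable_id _ _ _).
  - by move=> r r0; exact: exprn_ge0.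
  - by move=> r s r0 s0 rs; rewrite lerXn2r.
have fP : P (Z @^-1` Bad t rho) \is a fin_num.
  apply: fin_num_measure; have := mZ measurableT _ (mBad t rho); rewrite setTI; exact.
move: mk; rewrite -(fineK fP) -EFinM !lee_fin => mk.
by rewrite ler_pdivlMr// mulrC.
Qed.
End tracking.

(** * Entropy of the shift *)

Section entropy_of_trackable.
Context (R : realType) (X : completeMetricType R)
  (mu : probability (borel (path_space X)) R).
Hypothesis mu_invariant : theta_invariant mu.
Notation shift := (@left_shift X).

(** The message is the string of symbols up to time [t0 + m + n], of which there
    are [M ^ (t0 + m + n)]. The decoder is run on this string, and the cell of
    the path at time [t0 + i] is guessed from the decoded states at times
    [t0 + i, ..., t0 + i + m - 1]; the guess can only be wrong if the shifted
    path is exceptional for the partition or if one of these [m] states is badly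
    decoded. The itinerary starts at [t0], past the times where the decoder may
    be inaccurate, which does not change its law as [mu] is invariant. *)
Lemma trackable_entropy_le (M : nat) (I : finType)
    (A : I -> set (borel (path_space X))) (delta : R) :
  (0 < M)%N -> finite_measurable_partition A -> 0 < delta ->
  (forall eps, 0 < eps -> trackable mu M eps) ->
  exists c : nat, forall n : nat,
    partition_entropy mu (@iterated_join _ (borel (path_space X)) shift I A n) <=
      (c + n)%:R * log2 M%:R + n%:R * (2 * delta).
Proof.
move=> M0 pA delta0 track; have [mA tA UA] := pA.
have ln2_gt0 : 0 < ln 2 :> R by rewrite ln_gt0// ltr1n.
have /choice[a aP] : forall z : nat -> X, exists i, A i z.
  by move=> z; have [i _ Aiz] : (\bigcup_i A i) z by [rewrite UA|]; exists i.
have aE z i : A i z -> a z = i.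
  by move=> Aiz; apply: (tA _ _ Logic.I Logic.I); exists z.
have cI : (0 < #|I|)%N by apply/card_gt0P; exists (a point).
(* With this noise level a right guess costs exactly delta bits. *)
pose eta : R := 1 - expR (- (delta * ln 2)).
have eta0 : 0 < eta by rewrite subr_gt0 expR_lt1 oppr_lt0 mulr_gt0.
have eta1 : eta < 1 by rewrite ltrBlDr ltrDl expR_gt0.
have etaE : - log2 (1 - eta) = delta.
  by rewrite /log2 /eta opprB addrC subrK expRK mulNr opprK mulfK// gt_eqF.
pose K := log2 (#|I|%:R / eta).
have K0 : 0 <= K.
  rewrite divr_ge0 ?(ltW ln2_gt0)// ln_ge0// ler_pdivlMr// mul1r.
  by rewrite (le_trans (ltW eta1))// ler1n.
(* A wrong guess costs at most K more bits: at error rate beta this amounts to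
   at most delta bits on average. *)
pose beta := delta / (K + 1).
have beta0 : 0 < beta by rewrite divr_gt0// ltr_wpDl.
have betaK : beta * K <= delta.
  rewrite /beta mulrAC ler_pdivrMr ?ltr_wpDl//.
  by rewrite ler_pM2l// lerDl.
have beta2 : 0 < beta / 2 by rewrite divr_gt0.
have [m [rho [g [E [rho0 mE muE gP]]]]] := decodable_partition mu pA beta2.
(* The m states of a window are then all within rho, except with probability
   m * (2 * eps / rho ^+ 2) <= beta / 2. *)
pose eps := beta * rho ^+ 2 / (4 * m.+1%:R).
have rho20 : 0 < rho ^+ 2 by rewrite exprn_gt0.
have eps0 : 0 < eps by rewrite divr_gt0// mulr_gt0.
have [q [dec [mq dec_local [t0 bad]]]] := track _ eps0.
exists (t0 + m)%N => n.
pose L := (t0 + m + n)%N.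
pose m0 : 'I_M := Ordinal M0.
pose ext (u : {ffun 'I_L -> 'I_M}) (j : nat) : 'I_M :=
  if insub j is Some i then u i else m0.
pose S (k : nat) (z : borel (path_space X)) : {ffun 'I_n -> I} :=
  [ffun i : 'I_n => a (iter (k + i) shift z)].
pose U (z : borel (path_space X)) : {ffun 'I_L -> 'I_M} := [ffun j : 'I_L => q z j].
pose G (i : 'I_n) (u : {ffun 'I_L -> 'I_M}) : I :=
  g (fun j => dec (ext u) (t0 + i + j)%N).
have joinE s : @iterated_join _ (borel (path_space X)) shift I A n s =
    [set z | S 0%N z = s].
  apply/seteqP; split => [z h|z <- i].
    by apply/ffunP => i; rewrite ffunE add0n; apply: aE; exact: h.
  by rewrite ffunE add0n; exact: aP.
have mS k s : measurable ([set z | S k z = s] : set (borel (path_space X))).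
  rewrite (_ : [set _ | _] =
      [set z | forall i : 'I_n, (iter (k + i) shift @^-1` A (s i)) z]).
    apply: measurable_forall_fin => i; exact: iter_shift_measurable.
  apply/seteqP; split => [z <- i|z h].
    by rewrite ffunE; exact: aP.
  by apply/ffunP => i; rewrite ffunE; apply: aE; exact: h.
have mU u : measurable ([set z | U z = u] : set (borel (path_space X))).
  rewrite (_ : [set _ | _] = [set z | forall j : 'I_L, q z j = u j]).
    by apply: measurable_forall_fin => i; exact: mq.
  apply/seteqP; split => [z <- i|z h]; first by rewrite ffunE.
  by apply/ffunP => i; rewrite ffunE.
pose J := ({ffun 'I_n -> I} * {ffun 'I_L -> 'I_M})%type.
pose Phi z : J := (S t0 z, U z).
have mPhi su : measurable [set z | Phi z = su].
  case: su => s u; rewrite (_ : [set _ | _] =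
    [set z | S t0 z = s] `&` [set z | U z = u]); first exact: measurableI.
  by apply/seteqP; split => z /= => [[-> ->]|[<- <-]].
pose p s u := fine (mu [set z | Phi z = (s, u)]).
have sum_p (C : pred ({ffun 'I_n -> I} * {ffun 'I_L -> 'I_M})) :
    \sum_(s : {ffun 'I_n -> I}) \sum_(u : {ffun 'I_L -> 'I_M} | C (s, u)) p s u =
      fine (mu [set z | C (Phi z)]).
  rewrite -finite_valued_law// pair_big_dep/=.
  by apply: eq_big => [[s u]|[s u] _].
have pS s : \sum_u p s u =
    fine (mu (@iterated_join _ (borel (path_space X)) shift I A n s)).
  rewrite joinE -(@iter_shift_invariant R X mu t0 _ mu_invariant (mS 0%N s)).
  transitivity (fine (mu [set z | [pred su | su.1 == s] (Phi z)])).
    rewrite -(sum_p [pred su | su.1 == s]) (bigD1 s)//= [X in _ + X]big1 ?addr0.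
      by apply: eq_bigl => u; rewrite eqxx.
    by move=> s' /negbTE ns; rewrite big_pred0// => u; rewrite ns.
  congr (fine (mu _)); apply/seteqP; split => z /= => [/eqP <-|<-].
    by apply/ffunP => i; rewrite !ffunE add0n addnC iterD.
  by apply/eqP/ffunP => i; rewrite !ffunE add0n addnC iterD.
have -> : partition_entropy mu (@iterated_join _ (borel (path_space X)) shift I A n) =
    - \sum_(s : {ffun 'I_n -> I}) (\sum_u p s u) * log2 (\sum_u p s u).
  by rewrite /partition_entropy; congr (- _); apply: eq_bigr => s _; rewrite pS.
have err (i : 'I_n) : \sum_(s : {ffun 'I_n -> I}) \sum_(u | s i != G i u) p s u <= beta.
  rewrite (sum_p (fun su => su.1 i != G i su.2)) /=.
  pose Bad t := [set z : borel (path_space X) | rho <= mdist (z t : X) (dec (q z) t)].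
  have badP (j : nat) := bad (t0 + i + j)%N
    (leq_trans (leq_addr i t0) (leq_addr j _)) _ rho0.
  pose BadU := \big[setU/set0]_(j < m) Bad (t0 + i + j)%N.
  have mBadU : measurable BadU.
    by apply: bigsetU_measurable => j _; have [] := badP j.
  have muBadU : (mu BadU <= (beta / 2)%:E)%E.
    apply: (@le_trans _ _ (\sum_(j < m) mu (Bad (t0 + i + j)%N))).
      apply: (@Boole_inequality _ R _ mu (fun j => Bad (t0 + i + j)%N)).
      by move=> j _; have [] := badP j.
    apply: (@le_trans _ _ (\sum_(j < m) (2 * eps / rho ^+ 2)%:E)%E).
      by apply: lee_sum => j _; have [] := badP j.
    rewrite sumEFin lee_fin sumr_const card_ord -[leLHS]mulr_natr.
    have -> : 2 * eps / rho ^+ 2 = beta / 2 / m.+1%:R.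
      by rewrite /eps; field; rewrite nat1r pnatr_eq0 (gt_eqF rho0).
    by rewrite mulrAC ler_pdivrMr ?ltr0n// ler_pM2l// ler_nat.
  pose E' := iter (t0 + i) shift @^-1` E.
  have mE' : measurable (E' : set (borel (path_space X))) by exact: iter_shift_measurable.
  have muE' : (mu E' <= (beta / 2)%:E)%E.
    by rewrite /E' (iter_shift_invariant _ mu_invariant mE).
  have sub : [set z | S t0 z i != G i (U z)] `<=` E' `|` BadU.
    move=> z /= /negP ne; apply: contrapT => /not_orP[nE nB]; apply: ne; apply/eqP.
    rewrite ffunE; apply/esym; apply: (gP (iter (t0 + i) shift z)) (aP _) => //.
    move=> j jm; rewrite iter_shiftE.
    have -> : dec (ext (U z)) (t0 + i + j)%N = dec (q z) (t0 + i + j)%N.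
      apply: dec_local => k kL.
      have kL' : (k < L)%N.
        apply: leq_ltn_trans kL _; rewrite /L -!addnA ltn_add2l addnC.
        by rewrite -addSn leq_add// ltnW.
      by rewrite /ext insubT ffunE.
    rewrite ltNge; apply/negP => le; apply: nB.
    by rewrite /BadU (bigD1 (Ordinal jm))//=; left.
  have mErr : measurable ([set z | S t0 z i != G i (U z)] : set (borel (path_space X))).
    by have := finite_valued_measurable mPhi [set su : J | su.1 i != G i su.2].
  rewrite -lee_fin fineK; last exact: fin_num_measure.
  apply: (@le_trans _ _ (mu (E' `|` BadU))).
    by apply: le_measure => //; rewrite inE//; exact: measurableU.
  apply: le_trans (measureU2 _ mE' mBadU) _.
  by rewrite (splitr beta) EFinD leeD.
have p0 s u : 0 <= p s u by rewrite /p fine_ge0.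
have p1 : \sum_(s : {ffun 'I_n -> I}) \sum_u p s u = 1.
  rewrite (sum_p xpredT) (_ : [set _ | _] = setT) ?probability_setT//.
  by apply/seteqP; split.
have cU : (0 < #|{ffun 'I_L -> 'I_M}|)%N by apply/card_gt0P; exists [ffun=> m0].
apply: le_trans (entropy_decoding p0 p1 cU cI eta0 eta1 err) _.
rewrite card_ffun !card_ord natrX etaE -/K lerD//.
  by rewrite /log2 lnXn ?ltr0n// [leLHS]mulrnAl mulr_natl.
by rewrite ler_wpM2l// mulrDl mul1r lerD2l.
Qed.
(** The bound on the entropy of the [n]-th join divided by [n]: the initial
    delay [c] disappears in the limit. *)
Lemma trackable_ks_entropy_le (M : nat) :
  (0 < M)%N -> (forall eps, 0 < eps -> trackable mu M eps) ->
  (ks_entropy mu (shift : borel (path_space X) -> borel (path_space X)) <=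
    (log2 M%:R)%:E)%E.
Proof.
move=> M0 track.
have ln2_gt0 : 0 < ln 2 :> R by rewrite ln_gt0// ltr1n.
have lM0 : 0 <= log2 M%:R :> R.
  by rewrite divr_ge0 ?(ltW ln2_gt0)// ln_ge0// ler1n.
apply/ereal_supP => _ [k [A [pA ->]]].
rewrite /partition_ks_entropy; set u := fun n => _.
(* A divergent sequence has the default limit 0. *)
have [cu|/dvgP ->] := pselect (cvgn u); last by rewrite lee_fin.
apply/lee_addgt0Pr => e e0; apply: lime_le => //.
have e4 : 0 < e / 4 by rewrite divr_gt0.
have [c cP] := trackable_entropy_le M0 pA e4 track.
pose r := c%:R * log2 M%:R / (e / 2).
near=> n.
have n0 : 0 < n%:R :> R by rewrite ltr0n; near: n; exists 1%N.
rewrite /u -EFinD lee_fin ler_pdivrMr//; apply: le_trans (cP n) _.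
have rn : r <= n%:R by near: n; exact: nbhs_infty_ger.
move: rn; rewrite /r ler_pdivrMr ?divr_gt0// natrD mulrDl => rn.
lra.
Unshelve. all: by end_near. Qed.
End entropy_of_trackable.

Theorem mainTheorem3
  (R : realType) (X : completeMetricType R)
  (dW : measure_display) (W : measurableType dW)
  (f : borel X * W -> borel X)
  (f_meas : measurable_fun setT f)
  (f_homeo : forall w : W, homeomorphism ((fun x : X => f (x, w)) : X -> X))
  (nu : probability W R) (pi0 : probability (borel X) R)
  (pi0_stationary : stationary f nu pi0)
  (pi0_ergodic : ergodic f nu pi0)
  (dO : measure_display) (Omega : measurableType dO) (P : probability Omega R)
  (x : nat -> Omega -> borel X) (w : nat -> Omega -> W)
  (x_process : system_process f nu P pi0 x w)
  (mu : probability (borel (path_space X)) R)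
  (mu_invariant : theta_invariant mu)
  (mu_law : path_law f nu pi0 mu)
  (supp_compact : compact (supp mu)) :
  (ks_entropy mu (@left_shift X) <= C0 P x)%E.
Proof.
apply/ereal_infP => _ [M [M0 ach] <-].
apply: trackable_ks_entropy_le => // eps eps0.
by apply: (achieves_tracking f_meas x_process mu_law M0 eps0); exact: ach.
Qed.
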